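(* There is a positive constant $\kappa'$ and infinitely many positive integers $n$ with $$D'(n)\ge\frac12-\frac{\kappa'}{(\log\log n)^{1-\frac{\mathrm{e}}{2}\log 2}(\log\log\log n)^{1/2}}.$$
   Context: For a positive integer $n$ and subsets $\mathcal{A},\mathcal{B}$ of $\mathbb{Z}/n\mathbb{Z}$, $\mathcal{A}+\mathcal{B}=\{a+b: a\in\mathcal{A}, b\in\mathcal{B}\}$ and $\mathcal{A}\cdot\mathcal{B}=\{ab: a\in\mathcal{A}, b\in\mathcal{B}\}$ (when $\mathcal{A}=\mathcal{B}$ the two elements are allowed to be equal). A subset $\mathcal{A}\subset\mathbb{Z}/n\mathbb{Z}$ is sum-free if $\mathcal{A}\cap(\mathcal{A}+\mathcal{A})=\emptyset$, and product-free if $\mathcal{A}\cap(\mathcal{A}\cdot\mathcal{A})=\emptyset$. Set $D(\mathcal{A})=|\mathcal{A}|/n$, and $$D'(n)=\max\{D(\mathcal{A}): \mathcal{A}\text{ is a sum-free, product-free subset of }\mathbb{Z}/n\mathbb{Z}\}.$$ Here $\log$ is the natural logarithm and $\mathrm{e}$ is its base; the right-hand side is considered only for $n$ large enough that $\log\log\log n$ is defined and positive. *)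

(* Defs.v *)
From HB Require Import structures.
From mathcomp Require Import all_boot all_order all_algebra.
From mathcomp Require Import reals.

Set Implicit Arguments.
Unset Strict Implicit.
Unset Printing Implicit Defensive.

Import Order.TTheory GRing.Theory Num.Theory.

Local Open Scope ring_scope.

Definition sumset (S : finNzRingType) (A B : {set S}) : {set S} :=
  [set a + b | a in A, b in B].

Definition prodset (S : finNzRingType) (A B : {set S}) : {set S} :=
  [set a * b | a in A, b in B].

Definition sum_free (S : finNzRingType) (A : {set S}) : bool :=
  A :&: sumset A A == set0.

Definition product_free (S : finNzRingType) (A : {set S}) : bool :=
  A :&: prodset A A == set0.

(* The ring 'Z_n has n elements only for n > 1. For n = 1 it is Z/2, where no
   nonempty set is both sum-free and product-free, as in the zero ring, so
   [Dprime R 1] is nevertheless the right value 0. *)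
Definition density (R : realType) (n : nat) (A : {set 'Z_n}) : R :=
  #|A|%:R / n%:R.

(* The default value 0 of the maximum is the density of the empty set, which is
   sum-free and product-free. *)
Definition Dprime (R : realType) (n : nat) : R :=
  \big[Num.max/0]_(A : {set 'Z_n} | sum_free A && product_free A)
    density R A.

(* Main.v *)
Require Import Defs.
From HB Require Import structures.
From mathcomp Require Import all_boot all_order all_algebra.
From mathcomp Require Import all_classical all_reals all_analysis.
From mathcomp Require Import ring lra zify.

Import Order.TTheory GRing.Theory Num.Theory.
Import numFieldNormedType.Exports.

Local Open Scope ring_scope.

(** A set of odd residues modulo an even number is sum-free.  To make it
product-free as well, let L be the set of odd primes up to x, take
n = 2 * prod_(p in L) p^x, and let Omega(a) count the prime factors of a in L
with multiplicity, each prime being counted at most x times.  As long as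
Omega stays below x nothing is truncated and Omega is additive on products, so
for 2k <= x the odd residues with k <= Omega < 2k form a product-free set: a product of
two of them has Omega at least 2k.

It remains to see that few odd residues have Omega < k or Omega >= 2k.  By the
Chinese remainder theorem the generating function of Omega over the odd
residues factors over L, with local factor (1 - t) / (1 - tz), t = 1/p, up to
truncation ([sum_tOmega]).  Since 1 / (1 - tz) is bounded coefficientwise by
e^(tz) times a series 1 + 2 t^2 z^2 + 2 t^3 z^3 + ..., the distribution of
Omega is dominated by that of a Poisson variable of mean l = sum_(p in L) 1/p
plus an independent error whose weighted mass at z = 2 is bounded uniformly in
x, because sum 1/p^2 converges ([prod_tlogn_gf_le]).  Poisson weights satisfy
l^m/m! <= (l^J/J!) (l/J)^(m-J) for every m, so both tails are geometric series
and are bounded by a constant times the Poisson weight at their end point J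
([coef_exp_polyM_le], [coef_prod_tlogn_gf_le]).

With k close to c l the end points are c l and 2 c l, and the two weights are
of the same order exactly when c = e/4.  Stirling's lower bound for J!
([ln_fact_ge]) then bounds both by e^(-(1 - (e/2) log 2) l) / sqrt l, up to
constants ([Dprime_ge]).  Finally Euler's product gives log x <= B e^l
([ln_le_exp_recip_sum]) while trivially log n <= x^3, so that
log log n <= 3 B e^l, which turns the bound in l into the bound in n. *)

(** * Truncated valuations and the Chinese remainder theorem *)

(** Reduction modulo N and M is a bijection, so a sum of products of an
N-periodic and an M-periodic function factors. *)
Lemma sum_crt (V : comNzRingType) (N M : nat) (f g : nat -> V) :
  (0 < N)%N -> (0 < M)%N -> coprime N M ->
  (forall m, f (m %% N)%N = f m) -> (forall m, g (m %% M)%N = g m) ->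
  \sum_(m < N * M) f m * g m = (\sum_(m < N) f m) * (\sum_(m < M) g m).
Proof.
move=> N0 M0 coNM fN gM; rewrite big_distrlr pair_big /=.
pose h (m : 'I_(N * M)) :=
  (Ordinal (ltn_pmod m N0), Ordinal (ltn_pmod m M0)).
have h_inj : injective h.
  move=> m m' [eN eM]; apply/val_inj => /=.
  rewrite -[LHS](modn_small (ltn_ord m)) -[RHS](modn_small (ltn_ord m')).
  by apply/eqP; rewrite chinese_remainder // eN eM !eqxx.
rewrite (reindex h).
  by apply: eq_bigr => m _; rewrite /= fN gM.
apply: onW_bij; apply: inj_card_bij => //.
by rewrite card_prod !card_ord.
Qed.

(** The p-adic valuation capped at K.  Going through the gcd makes it a function
of m modulo p^K, with the value K at m = 0. *)
Definition tlogn (p K m : nat) : nat := logn p (gcdn m (p ^ K)).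

Lemma tlogn_modn p K m : tlogn p K (m %% p ^ K)%N = tlogn p K m.
Proof. by rewrite /tlogn gcdn_modl. Qed.

Lemma tlognS_mul p K a : prime p -> tlogn p K.+1 (a * p)%N = (tlogn p K a).+1.
Proof.
move=> pp; have p0 := prime_gt0 pp.
rewrite /tlogn expnSr -muln_gcdl lognM ?gcdn_gt0 ?expn_gt0 ?p0 ?orbT //.
by rewrite (pfactorK 1 pp) addn1.
Qed.

Lemma tlogn_notdvd p K m : prime p -> ~~ (p %| m)%N -> tlogn p K m = 0%N.
Proof.
move=> pp pm; have /eqP : coprime m (p ^ K).
  by rewrite coprime_sym coprimeXl // prime_coprime.
by rewrite /tlogn => ->; rewrite logn1.
Qed.

Lemma sum_mul (V : nmodType) (q M : nat) (f : nat -> V) :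
  \sum_(m < M * q) f m = \sum_(a < M) \sum_(b < q) f (a * q + b)%N.
Proof.
elim: M => [|M IH]; first by rewrite !big_ord0.
by rewrite big_ord_recr /= -IH mulSnr big_split_ord.
Qed.

(** The probability generating function of [tlogn p K] on residues modulo p^K,
for t = 1/p: the geometric law with its tail collected at K. *)
Definition tlogn_gf {R : realFieldType} (t : R) (K : nat) : {poly R} :=
  (1 - t) *: \poly_(i < K) t ^+ i + t ^+ K *: 'X^K.

Lemma tlogn_gfS (R : realFieldType) (t : R) K :
  tlogn_gf t K.+1 = (1 - t)%:P + t *: ('X * tlogn_gf t K).
Proof.
apply/polyP => j.
rewrite /tlogn_gf !(coefD, coefZ, coefC, coefXM, coef_poly, coefXn).
case: j => [|j] /=; first by rewrite expr0; ring.
rewrite ltnS eqSS; move: (_ == _)%:R => b.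
by rewrite exprS; case: ifP => _; rewrite ?exprS; ring.
Qed.

(** A residue modulo q^(K+1) either is prime to q or is q times a residue modulo
q^K, which is the recursion [tlogn_gfS]. *)
Lemma sum_tlogn (R : realFieldType) (q K : nat) : prime q ->
  \sum_(m < q ^ K) 'X^(tlogn q K m) = (q ^ K)%:R *: tlogn_gf (q%:R^-1 : R) K.
Proof.
move=> pq; have q0 := prime_gt0 pq.
have qn0 : (q%:R : R) != 0 by rewrite pnatr_eq0 -lt0n.
elim: K => [|K IH].
  rewrite big_ord1 /tlogn gcd0n logn1 expr0 /tlogn_gf expr0 scale1r expr0.
  by rewrite poly_def big_ord0 scaler0 add0r scale1r.
rewrite expnSr (sum_mul _ _ _ (fun m => 'X^(tlogn q K.+1 m))).
have -> : \sum_(a < q ^ K) \sum_(b < q) 'X^(tlogn q K.+1 (a * q + b)) =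
  \sum_(a < q ^ K) ('X * 'X^(tlogn q K a) + (q%:R - 1)%:P) :> {poly R}.
  apply: eq_bigr => a _.
  case: q pq q0 {IH qn0} a => // q pq _ a; rewrite big_ord_recl /= addn0.
  rewrite tlognS_mul // exprS; congr (_ + _).
  rewrite (eq_bigr (fun=> 1)) => [|b _].
    by rewrite sumr_const card_ord -natr1 addrK -polyC1 -polyCMn.
  rewrite tlogn_notdvd ?expr0 // dvdn_addr ?dvdn_mull //.
  by rewrite (gtnNdvd _ (ltn_ord (lift ord0 b))).
rewrite big_split /= -mulr_sumr IH sumr_const card_ord tlogn_gfS natrM.
move: (tlogn_gf _ K) => G.
rewrite scalerDr scalerA mulfK // -scalerAr addrC; congr (_ + _).
rewrite -polyCMn -[_ *: _%:P]mul_polyC -polyCM; congr (_%:P).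
rewrite -[LHS]mulr_natl -[RHS]mulrA; congr (_ * _).
by rewrite [RHS]mulrBr mulr1 divff.
Qed.

Definition tOmega (L : seq nat) (K m : nat) : nat := \sum_(p <- L) tlogn p K m.

Lemma prod_exp_gt0 (L : seq nat) K : all prime L -> (0 < \prod_(p <- L) p ^ K)%N.
Proof.
move=> /allP Lp; rewrite big_seq prodn_cond_gt0 // => p pL.
by rewrite expn_gt0 prime_gt0 // Lp.
Qed.

Lemma tOmega_modn (L : seq nat) K m n :
  (forall p, p \in L -> p ^ K %| n)%N -> tOmega L K (m %% n) = tOmega L K m.
Proof.
move=> Ln; rewrite /tOmega big_seq [RHS]big_seq; apply: eq_bigr => p pL.
by rewrite -tlogn_modn modn_dvdm ?tlogn_modn // Ln.
Qed.

Lemma dvdn_prod_exp (L : seq nat) K p :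
  p \in L -> (p ^ K %| \prod_(q <- L) q ^ K)%N.
Proof. by move=> pL; rewrite (big_rem p) //= dvdn_mulr. Qed.

Lemma coprime_prod_exp (L : seq nat) K q : prime q -> all prime L ->
  q \notin L -> coprime (q ^ K) (\prod_(p <- L) p ^ K).
Proof.
move=> pq /allP Lp qL; rewrite big_seq.
elim/big_ind: _ => [|a b|p pL]; first by rewrite coprimen1.
  by move=> ca cb; rewrite coprimeMr ca.
apply/coprimeXl/coprimeXr; rewrite prime_coprime // dvdn_prime2 //; last exact: Lp.
by apply: contra qL => /eqP ->.
Qed.

Lemma sum_tOmega (R : realFieldType) (L : seq nat) K : uniq L -> all prime L ->
  \sum_(m < \prod_(p <- L) p ^ K) 'X^(tOmega L K m) =
  \prod_(p <- L) ((p ^ K)%:R *: tlogn_gf (p%:R^-1 : R) K).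
Proof.
elim: L => [_ _|q L IH /= /andP[qL uL] /andP[pq Lp]].
  by rewrite !big_nil big_ord1 /tOmega big_nil.
rewrite !big_cons -IH // -sum_tlogn //.
rewrite -(sum_crt _ _ _ (fun m => 'X^(tlogn q K m))
  (fun m => 'X^(tOmega L K m))).
- by apply: eq_bigr => m _; rewrite /tOmega big_cons exprD.
- by rewrite expn_gt0 prime_gt0.
- exact: prod_exp_gt0.
- exact: coprime_prod_exp.
- by move=> m; rewrite tlogn_modn.
- by move=> m; rewrite tOmega_modn // => p; apply: dvdn_prod_exp.
Qed.

(** * Domination by a Poisson distribution *)

(** The exponential series e^(aX) cut off after degree M. *)
Definition exp_poly {R : realFieldType} (M : nat) (a : R) : {poly R} :=
  \poly_(i < M.+1) (a ^+ i / i`!%:R).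

(** The series 1 + 2 t^2 X^2 + 2 t^3 X^3 + ... cut off after degree M.  It has no
term of degree 1, so at X = 2 it is 1 + O(t^2) ([tail_poly_horner2]) and the
product over t = 1/p stays bounded.  The factor 2 is room for the collected
tail of [tlogn_gf] at degree K. *)
Definition tail_poly {R : realFieldType} (M : nat) (t : R) : {poly R} :=
  \poly_(i < M.+1) (if (2 <= i)%N then 2 * t ^+ i else (i == 0)%:R).

Lemma coef_exp_polyM (R : realFieldType) M (a b : R) j : (j <= M)%N ->
  (exp_poly M a * exp_poly M b)`_j = (exp_poly M (a + b))`_j.
Proof.
move=> jM; rewrite coefM coef_poly ltnS jM addrC exprDn mulr_suml.
apply: eq_bigr => i _; have ij : (i <= j)%N by rewrite -ltnS.
rewrite !coef_poly !ltnS (leq_trans ij jM) (leq_trans (leq_subr i j) jM).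
have f0 n : n`!%:R != 0 :> R by rewrite pnatr_eq0 -lt0n fact_gt0.
rewrite -(bin_fact ij) !natrM -mulr_natr.
have := f0 i; have := f0 (j - i)%N; have : 'C(j, i)%:R != 0 :> R.
  by rewrite pnatr_eq0 -lt0n bin_gt0.
move=> c0 d0 e0; field; exact/and3P.
Qed.

Lemma exp_poly_nneg (R : realFieldType) M (a : R) : 0 <= a ->
  exp_poly M a \is a polyOver Num.nneg.
Proof.
move=> a0; apply/polyOverP => i; rewrite coef_poly nnegrE.
by case: ifP => // _; rewrite divr_ge0 ?exprn_ge0 ?ler0n.
Qed.

Lemma tail_poly_nneg (R : realFieldType) M (t : R) : 0 <= t ->
  tail_poly M t \is a polyOver Num.nneg.
Proof.
move=> t0; apply/polyOverP => i; rewrite coef_poly nnegrE.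
by case: ifP => // _; case: ifP => // _; rewrite ?ler0n // mulr_ge0 ?exprn_ge0.
Qed.

Lemma nneg_polyM (R : realFieldType) (p q : {poly R}) :
  p \is a polyOver Num.nneg -> q \is a polyOver Num.nneg ->
  p * q \is a polyOver Num.nneg.
Proof.
move=> /polyOverP p0 /polyOverP q0; apply/polyOverP => i.
by rewrite nnegrE coefM sumr_ge0 // => j _; rewrite mulr_ge0 // -nnegrE.
Qed.

Lemma nneg_poly_prod (R : realFieldType) (s : seq R) (F : R -> {poly R}) :
  (forall t, t \in s -> F t \is a polyOver Num.nneg) ->
  \prod_(t <- s) F t \is a polyOver Num.nneg.
Proof.
move=> F0; rewrite big_seq; elim/big_ind: _ => //; last exact: nneg_polyM.
by apply/polyOverP => i; rewrite nnegrE coef1 ler0n.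
Qed.

Lemma geom_le (R : realFieldType) (y : R) n : 0 <= y < 1 ->
  \sum_(i < n) y ^+ i <= (1 - y)^-1.
Proof.
move=> /andP[y0 y1]; have p1 : 0 < 1 - y by rewrite subr_gt0.
by rewrite -(ler_pM2l p1) divff ?gt_eqF // -opprB mulNr -subrX1 opprB gerBl exprn_ge0.
Qed.

(** Every degree is covered by a single term of the product: degrees 0 and 1 by
those of the exponential, and degrees at least 2 by those of [tail_poly]. *)
Lemma tlogn_gf_le (R : realFieldType) M K (t : R) j :
  0 <= t <= 1 / 3 -> (2 <= K)%N -> (j <= M)%N ->
  (tlogn_gf t K)`_j <= (1 - t) * (exp_poly M t * tail_poly M t)`_j.
Proof.
move=> /andP[t0 t3] K2 jM; have t1 : 0 <= 1 - t by lra.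
have le1 i : (i <= j)%N ->
    (exp_poly M t)`_i * (tail_poly M t)`_(j - i) <=
    (exp_poly M t * tail_poly M t)`_j.
  move=> ij; rewrite coefM (bigD1 (Ordinal (ij : (i < j.+1)%N))) //= lerDl.
  apply: sumr_ge0 => k _.
  by rewrite mulr_ge0 // -nnegrE (polyOverP _) ?exp_poly_nneg ?tail_poly_nneg.
have le2 : (if (2 <= j)%N then 2 * t ^+ j else t ^+ j) <=
    (exp_poly M t * tail_poly M t)`_j.
  have [j2|j2] := leqP 2 j.
    apply: le_trans (le1 0%N (leq0n _)).
    by rewrite !coef_poly !ltnS subn0 leq0n jM j2 expr0 fact0 divr1 mul1r.
  apply: le_trans (le1 j (leqnn _)).
  rewrite subnn !coef_poly ltnS jM /= mulr1.
  by case: j j2 {jM le1} => [|[|]] //= _; rewrite divr1.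
apply: (@le_trans _ _ ((1 - t) * (if (2 <= j)%N then 2 * t ^+ j else t ^+ j)));
  last exact: ler_wpM2l.
rewrite /tlogn_gf coefD !coefZ coef_poly coefXn.
have tj : 0 <= t ^+ j by rewrite exprn_ge0.
have [jK|jK|->] := ltngtP j K.
- by rewrite mulr0 addr0 ler_wpM2l //; case: ifP => _ //; lra.
- by rewrite !mulr0 add0r mulr_ge0 //; case: ifP => _ //; lra.
- by rewrite mulr0 add0r mulr1 K2 mulrA ler_peMl ?exprn_ge0 //; lra.
Qed.

(** The local bounds multiply because all coefficients are nonnegative, and the
exponentials combine into the one whose parameter is the sum of the t. *)
Lemma prod_tlogn_gf_le (R : realFieldType) M K (s : seq R) j :
  (forall t, t \in s -> 0 <= t <= 1 / 3) -> (2 <= K)%N -> (j <= M)%N ->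
  0 <= (\prod_(t <- s) tlogn_gf t K)`_j <=
  \prod_(t <- s) (1 - t) *
    (exp_poly M (\sum_(t <- s) t) * \prod_(t <- s) tail_poly M t)`_j.
Proof.
move=> s01 K2; elim: s s01 j => [_|t s IH s01] j jM.
  rewrite !big_nil mulr1 mul1r coef1 ler0n coef_poly ltnS jM.
  by case: j {jM} => [|j]; rewrite ?expr0 ?fact0 ?divr1 ?expr0n ?mul0r /=.
have /andP[t0 t3] := s01 t (mem_head _ _).
have t1 : 0 <= 1 - t by lra.
have s01' u : u \in s -> 0 <= u <= 1 / 3.
  by move=> us; apply: s01; rewrite inE us orbT.
have {}IH i (ij : (i <= j)%N) := IH s01' i (leq_trans ij jM).
rewrite !big_cons coefM; apply/andP; split.
  apply: sumr_ge0 => i _; rewrite mulr_ge0 //; last first.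
    by case/andP: (IH (j - i)%N (leq_subr _ _)).
  rewrite /tlogn_gf coefD !coefZ coef_poly coefXn.
  by rewrite addr_ge0 ?mulr_ge0 ?ler0n ?exprn_ge0 //;
    case: ifP => // _; rewrite exprn_ge0.
set S := \sum_(t <- s) t; set P := \prod_(t <- s) (1 - t).
set T := \prod_(t <- s) tail_poly M t.
have -> : (exp_poly M (t + S) * (tail_poly M t * T))`_j =
   ((exp_poly M t * exp_poly M S) * (tail_poly M t * T))`_j.
  rewrite !coefM; apply: eq_bigr => i _; congr (_ * _).
  by rewrite -coef_exp_polyM // (leq_trans _ jM) // -ltnS.
have -> : exp_poly M t * exp_poly M S * (tail_poly M t * T) =
  (exp_poly M t * tail_poly M t) * (exp_poly M S * T) by ring.
rewrite coefM mulr_sumr; apply: ler_sum => i _.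
have ij : (i <= j)%N by rewrite -ltnS.
have /andP[? ?] := IH (j - i)%N (leq_subr _ _).
have -> (x y : R) : (1 - t) * P * (x * y) = ((1 - t) * x) * (P * y) by ring.
apply: ler_pM => //; last by rewrite tlogn_gf_le ?t0 // (leq_trans ij).
rewrite /tlogn_gf coefD !coefZ coef_poly coefXn.
by rewrite addr_ge0 ?mulr_ge0 ?ler0n ?exprn_ge0 //;
    case: ifP => // _; rewrite exprn_ge0.
Qed.

Lemma tail_poly_horner2 (R : realFieldType) M (t : R) : 0 <= t <= 1 / 3 ->
  (tail_poly M t).[2] <= 1 + 24 * t ^+ 2.
Proof.
move=> /andP[t0 t3]; rewrite horner_poly.
apply: (@le_trans _ _ (1 + \sum_(i < M) (if (1 <= i)%N then 2 * (2 * t) ^+ i.+1 else 0))).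
  rewrite big_ord_recl /= expr0 mulr1 lerD2l; apply: ler_sum => i _.
  rewrite /bump leq0n add1n ltnS; case: ifP => _; rewrite ?mul0r //.
  by rewrite exprMn -mulrA [t ^+ _ * _]mulrC.
rewrite lerD2l; case: M => [|M]; first by rewrite big_ord0 mulr_ge0 ?sqr_ge0.
rewrite big_ord_recl /= add0r.
have -> : \sum_(i < M) 2 * (2 * t) ^+ (bump 0 i).+1 =
    8 * t ^+ 2 * \sum_(i < M) (2 * t) ^+ i.
  by rewrite mulr_sumr; apply: eq_bigr => i _; rewrite /bump !exprS; ring.
have y1 : 0 <= 2 * t < 1 by lra.
have -> : 24 * t ^+ 2 = 8 * t ^+ 2 * 3 :> R by ring.
rewrite ler_wpM2l ?mulr_ge0 ?sqr_ge0 //.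
apply: le_trans (geom_le _ _ _ y1) _.
by rewrite invf_ple ?posrE //; lra.
Qed.

(** For m >= J the quotient m!/J! is a product of m - J factors larger than J, and
for m <= J the quotient J!/m! is a product of J - m factors at most J. *)
Lemma fact_exp_le (J m : nat) : (J`! * J ^ m <= m`! * J ^ J)%N.
Proof.
have lo d N : (m + d <= N)%N -> ((m + d)`! <= m`! * N ^ d)%N.
  elim: d => [|d IH] mN; first by rewrite addn0 expn0 muln1.
  rewrite addnS factS expnS mulnCA leq_mul //; first by rewrite -addnS.
  by apply: IH; apply: leq_trans mN; rewrite leq_add2l.
have [mJ|Jm] := leqP m J.
  have e : J = (m + (J - m))%N by rewrite subnKC.
  rewrite [X in (_ <= _ * _ ^ X)%N]e expnD mulnA mulnAC leq_mul2r.
  by rewrite [X in (X`! <= _)%N]e lo ?orbT // -e.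
rewrite -(subnKC (ltnW Jm)); elim: (m - J)%N => [|d IH]; first by rewrite addn0.
rewrite addnS expnSr factS mulnA [(_.+1 * _)%N]mulnC -[leqRHS]mulnAC leq_mul //.
by rewrite leqW // leq_addr.
Qed.

(** Poisson weights are log-concave in m, hence lie below the geometric
progression of ratio a / J through the weight at J, on both sides of J. *)
Lemma poisson_weight_le (R : realFieldType) (a : R) (J m : nat) :
  0 < a -> (0 < J)%N ->
  a ^+ m / m`!%:R <= a ^+ J / J`!%:R / (a / J%:R) ^+ J * (a / J%:R) ^+ m.
Proof.
move=> a0 J0.
have f0 n : 0 < n`!%:R :> R by rewrite ltr0n fact_gt0.
have p0 k : 0 < J%:R ^+ k :> R by rewrite exprn_gt0 // ltr0n.
have q0 k : 0 < a ^+ k by rewrite exprn_gt0.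
rewrite !exprMn !exprVn.
have -> : a ^+ J / J`!%:R / (a ^+ J / J%:R ^+ J) * (a ^+ m / J%:R ^+ m) =
   a ^+ m * (J%:R ^+ J / (J`!%:R * J%:R ^+ m)).
  have := (lt0r_neq0 (f0 J), lt0r_neq0 (p0 J), lt0r_neq0 (q0 J), lt0r_neq0 (p0 m)).
  move=> [[[h1 h2] h3] h4]; field; by rewrite h1 h2 h3 h4.
rewrite ler_pM2l // ler_pdivlMr ?mulr_gt0 // mulrC ler_pdivrMr //.
by rewrite -!natrX -!natrM ler_nat [leqRHS]mulnC fact_exp_le.
Qed.

Lemma horner_partial_le (R : realFieldType) (H : {poly R}) (y : R) n :
  H \is a polyOver Num.nneg -> 0 <= y ->
  \sum_(i < n) H`_i * y ^+ i <= H.[y].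
Proof.
move=> /polyOverP H0 y0; rewrite (horner_coef_wide _ (leq_maxl (size H) n)).
rewrite -!(big_mkord xpredT (fun i => H`_i * y ^+ i)).
rewrite [leRHS](@big_cat_nat _ _ _ n) ?leq_maxr //= lerDl sumr_ge0 // => i _.
by rewrite mulr_ge0 ?exprn_ge0 // -nnegrE.
Qed.

Lemma horner_nneg_le (R : realFieldType) (H : {poly R}) (y z : R) :
  H \is a polyOver Num.nneg -> 0 <= y <= z -> H.[y] <= H.[z].
Proof.
move=> /polyOverP H0 /andP[y0 yz]; rewrite !horner_coef; apply: ler_sum => i _.
by rewrite ler_wpM2l -?nnegrE // lerXn2r ?nnegrE // (le_trans y0).
Qed.

(** Convolution with H costs only a constant factor: the geometric majorant of
[poisson_weight_le] turns the convolution into an evaluation of H at J / a,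
which is at most 2. *)
Lemma coef_exp_polyM_le (R : realFieldType) M (a : R) (H : {poly R}) J j :
  H \is a polyOver Num.nneg -> 0 < a -> (0 < J)%N -> J%:R <= 2 * a ->
  (exp_poly M a * H)`_j <=
  a ^+ J / J`!%:R / (a / J%:R) ^+ J * H.[2] * (a / J%:R) ^+ j.
Proof.
move=> H0 a0 J0 Ja; set r := a / J%:R; set w := a ^+ J / J`!%:R / r ^+ J.
have Jr : 0 < J%:R :> R by rewrite ltr0n.
have r0 : 0 < r by rewrite divr_gt0.
have rj0 : 0 <= r ^+ j by rewrite exprn_ge0 // ltW.
have w0 : 0 <= w by rewrite !divr_ge0 ?exprn_ge0 ?ler0n // ltW.
have r2 : 0 <= r^-1 <= 2.
  by rewrite invr_ge0 ltW //= /r invf_div ler_pdivrMr.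
apply: (@le_trans _ _ (w * H.[r^-1] * r ^+ j)); last first.
  by rewrite ler_wpM2r // ler_wpM2l // horner_nneg_le.
apply: (@le_trans _ _ (w * (\sum_(i < j.+1) H`_i * r^-1 ^+ i) * r ^+ j)); last first.
  rewrite ler_wpM2r // ler_wpM2l // horner_partial_le //.
  by rewrite invr_ge0 ltW.
rewrite mulrC coefM mulrAC mulr_sumr; apply: ler_sum => i _.
rewrite mulrCA. rewrite ler_wpM2l ?(polyOverP _ _) -?nnegrE ?(polyOverP H0) //.
have ij : (i <= j)%N by rewrite -ltnS.
have -> : w * r ^+ j * r^-1 ^+ i = w * r ^+ (j - i).
  by rewrite exprVn -mulrA expfB_cond ?gt_eqF.
rewrite coef_poly; case: ifP => _; first exact: poisson_weight_le.
by rewrite mulr_ge0 ?exprn_ge0 // ltW.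
Qed.

(** * Stirling's lower bound and Poisson weights *)

(** The difference of the two sides vanishes at u = 0 and has derivative
- ln (1 - u^2) in u, which is nonnegative. *)
Lemma xlnx_gap_le (R : realType) (u : R) : 0 <= u < 1 ->
  (1 + u) * ln (1 + u) - (1 - u) * ln (1 - u) <= 2 * u.
Proof.
move=> /andP[u0 u1].
pose f (x : R) := 2 * x - ((1 + x) * ln (1 + x) - (1 - x) * ln (1 - x)).
pose df (x : R) := - ln (1 + x) - ln (1 - x).
have fdf (x : R) : -1 < x < 1 -> is_derive x 1 f (df x).
  move=> /andP[x0 x1].
  have p1 : 0 < 1 + x by lra.
  have p2 : 0 < 1 - x by lra.
  have d1 : is_derive x 1 (fun y : R => 1 + y) 1.
    by apply: (is_derive_eq (is_deriveD _ _)); rewrite add0r.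
  have d2 : is_derive x 1 (fun y : R => 1 - y) (-1).
    by apply: (is_derive_eq (is_deriveD _ _)); rewrite add0r.
  have l1 : is_derive x 1 (fun y : R => ln (1 + y)) (1 + x)^-1.
    have h := is_derive1_ln p1.
    by apply: (is_derive_eq (is_derive1_comp h d1)); rewrite mulr1.
  have l2 : is_derive x 1 (fun y : R => ln (1 - y)) (- (1 - x)^-1).
    have h := is_derive1_ln p2.
    have -> : - (1 - x)^-1 = (1 - x)^-1 * -1 by rewrite mulrN1.
    exact: (@is_derive1_comp R (@ln R) (fun y : R => 1 - y)).
  apply: (is_derive_eq (is_deriveB (is_deriveZ _ _)
    (is_deriveB (is_deriveM d1 l1) (is_deriveM d2 l2)))).
  rewrite /df /GRing.scale /=; field; rewrite ?gt_eqF //.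
have f_mono : f 0 <= f u.
  have [] := @MVT_segment R f df 0 u u0.
  - by move=> x; rewrite in_itv /= => /andP[? ?]; apply: fdf; lra.
  - apply: derivable_within_continuous => x; rewrite in_itv /= => /andP[? ?].
    by apply: ex_derive; apply: fdf; lra.
  move=> c; rewrite in_itv /= => /andP[c0 cu] e.
  rewrite -subr_ge0 e mulr_ge0 ?subr0 // /df -opprD oppr_ge0.
  rewrite -lnM ?posrE; [|lra|lra].
  by apply: ln_le0; have := sqr_ge0 c; rewrite expr2; lra.
by move: f_mono; rewrite /f !(mulr0, addr0, subr0, ln1) subr_ge0.
Qed.

(** This is [xlnx_gap_le] for u = 1 / (2 (j + 1)), scaled by j + 1. *)
Lemma stirling_step (R : realType) (j : nat) : (0 < j)%N ->
  (j%:R + 3 / 2) * ln (j%:R + 3 / 2 : R) <=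
  (j%:R + 1 / 2) * ln (j%:R + 1 / 2 : R) + ln (j.+1%:R) + 1.
Proof.
move=> j0; set y : R := j.+1%:R.
have y2 : 2 <= y by rewrite (ler_nat R 2).
have y0 : 0 < y by lra.
have -> : j%:R = y - 1 by rewrite /y -natr1 addrK.
pose u := (2 * y)^-1.
have uy : 2 * u * y = 1 by rewrite /u; field; rewrite gt_eqF.
have u0 : 0 < u by rewrite invr_gt0; lra.
have u1 : u < 1 by nra.
have e1 : y - 1 + 3 / 2 = y * (1 + u) by lra.
have e2 : y - 1 + 1 / 2 = y * (1 - u) by lra.
rewrite e1 e2 !lnM ?posrE //; [|lra|lra].
have := @xlnx_gap_le R u; rewrite u1 (ltW u0) => /(_ isT) h.
have : y * ((1 + u) * ln (1 + u) - (1 - u) * ln (1 - u)) <= 1.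
  by apply: le_trans (_ : y * (2 * u) <= 1); [rewrite ler_pM2l | lra].
have : y * (1 + u) * ln y - y * (1 - u) * ln y = ln y.
  rewrite -mulrBl (_ : y * (1 + u) - y * (1 - u) = 2 * u * y); last by ring.
  by rewrite uy mul1r.
lra.
Qed.

(** Stirling's formula with the half shift: in terms of j + 1/2 instead of j, the
difference of the two sides increases with j, so the lower bound follows by
induction. *)
Lemma ln_fact_ge (R : realType) (j : nat) : (0 < j)%N ->
  (j%:R + 1 / 2) * ln (j%:R + 1 / 2 : R) - j%:R <= ln (j`!%:R : R).
Proof.
elim: j => // -[_ _|j IH _].
  rewrite (_ : 1`! = 1)%N // ln1.
  have : ln (3 / 2 : R) <= 1 / 2.
    by have := @le_ln1Dx R (1 / 2); rewrite (_ : 1 + 1 / 2 = 3 / 2); last lra; apply; lra.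
  by rewrite (_ : 1 + 1 / 2 = 3 / 2 :> R); last lra; lra.
have {}IH := IH isT.
rewrite factS natrM lnM ?posrE ?ltr0n ?fact_gt0 //.
have := @stirling_step R j.+1 isT.
rewrite (_ : j.+2%:R = j.+1%:R + 1 :> R); last by rewrite natr1.
rewrite (_ : j.+1%:R + 1 + 1 / 2 = j.+1%:R + 3 / 2 :> R); last by lra.
by move: IH; lra.
Qed.

(** The weight e^(-mu) mu^j / j! is largest at mu = j, where Stirling's bound
gives 1 / sqrt j. *)
Lemma poisson_le (R : realType) (mu : R) (j : nat) : 0 < mu -> (0 < j)%N ->
  mu ^+ j / j`!%:R * Num.sqrt j%:R <= expR mu.
Proof.
move=> mu0 j0.
have jR : 0 < j%:R :> R by rewrite ltr0n.
have f0 : 0 < j`!%:R :> R by rewrite ltr0n fact_gt0.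
have s0 : 0 < Num.sqrt j%:R :> R by rewrite sqrtr_gt0.
rewrite -ler_ln ?posrE ?expR_gt0 ?mulr_gt0 ?invr_gt0 ?exprn_gt0 //.
rewrite expRK !lnM ?posrE ?mulr_gt0 ?invr_gt0 ?exprn_gt0 // lnV ?posrE // lnXn //.
have -> : ln (Num.sqrt j%:R) = 1 / 2 * ln j%:R :> R.
  rewrite -[in RHS](sqr_sqrtr (ltW jR)) lnXn //.
  by rewrite -[_ *+ 2]mulr_natl; lra.
have h1 := @ln_fact_ge R j j0.
have h2 : (j%:R + 1 / 2) * ln (j%:R : R) <= (j%:R + 1 / 2) * ln (j%:R + 1 / 2 : R).
  by rewrite ler_pM2l; [rewrite ler_ln ?posrE; lra | lra].
have h3 : j%:R * (ln mu - ln (j%:R : R)) <= mu - j%:R.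
  rewrite -ln_div ?posrE //.
  apply: (@le_trans _ _ (j%:R * (mu / j%:R - 1))); last first.
    by rewrite mulrBr mulr1 mulrCA divff ?gt_eqF // mulr1.
  rewrite ler_pM2l //.
  have e : mu / j%:R = 1 + (mu / j%:R - 1) by rewrite [RHS]addrC subrK.
  rewrite [X in ln X <= _]e; apply: le_ln1Dx.
  by rewrite ltrBDl addrN divr_gt0.
rewrite -[_ *+ j]mulr_natl; move: h1 h2 h3; rewrite !mulrBr !mulrDl; lra.
Qed.

(** * Reciprocals of the odd primes *)

(** The finite form of Euler's product.  Grouping the elements of s by their
q-adic valuation i and dividing each group by q^i reduces the primes q :: L to
the primes L. *)
Lemma sum_inv_smooth (R : realFieldType) (L s : seq nat) :
  all prime L -> uniq s ->
  (forall m, m \in s -> (0 < m)%N /\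
     forall p, prime p -> (p %| m)%N -> p \in L) ->
  \sum_(m <- s) (m%:R^-1 : R) <= \prod_(p <- L) (1 - p%:R^-1)^-1.
Proof.
elim: L s => [|q L IH] s /=.
  move=> _ us sm; rewrite big_nil.
  have s1 m : m \in s -> m = 1%N.
    move=> /sm [m0 mp]; apply/eqP; rewrite eqn_leq m0 andbT leqNgt.
    by apply/negP => m1; have := mp _ (pdiv_prime m1) (pdiv_dvd m).
  case: s us s1 {sm} => [|a [|b s]] us s1.
  - by rewrite big_nil.
  - by rewrite big_seq1 (s1 a) ?mem_head // invr1.
  - have := s1 a (mem_head _ _).
    have := s1 b; rewrite !inE eqxx orbT => /(_ isT) b1 a1.
    by move: us; rewrite a1 b1.
move=> /andP[pq pL] us sm.
have q1 : 1 < q%:R :> R by rewrite (ltr_nat R 1) prime_gt1.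
pose I := (\max_(m <- s) m)%N.
have sI m : m \in s -> (logn q m < I.+1)%N.
  move=> ms; rewrite ltnS (@leq_trans m) //; last exact: leq_bigmax_seq.
  by have [m0 _] := sm m ms; rewrite ltnW // ltn_logl.
rewrite big_cons (partition_big (fun m => inord (logn q m) : 'I_I.+1) xpredT) //=.
set B := \prod_(p <- L) _.
have B0 : 0 <= B.
  rewrite /B big_seq; apply: prodr_ge0 => p pL'; rewrite invr_ge0 subr_ge0.
  have p0 : (0 < p)%N by rewrite prime_gt0 // (allP pL).
  by rewrite invf_le1 ?ltr0n // ler1n.
have step (i : 'I_I.+1) :
    \sum_(m <- s | inord (logn q m) == i) (m%:R^-1 : R) <= (q%:R^-1) ^+ i * B.
  pose si := [seq m <- s | inord (logn q m) == i].
  have siP m : m \in si -> m \in s /\ logn q m = i.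
    rewrite mem_filter => /andP[/eqP e ms]; split=> //.
    by rewrite -e inordK // sI.
  have dK m : m \in si -> (m %/ q ^ i * q ^ i = m)%N.
    by move=> /siP[_ <-]; rewrite divnK // pfactor_dvdnn.
  rewrite -big_filter -/si.
  have -> : \sum_(m <- si) (m%:R^-1 : R) =
      q%:R^-1 ^+ i * \sum_(m <- [seq m %/ q ^ i | m <- si]%N) m%:R^-1.
    rewrite big_map mulr_sumr big_seq [RHS]big_seq; apply: eq_bigr => m ms.
    by rewrite -{1}(dK m ms) natrM invfM natrX exprVn mulrC.
  rewrite ler_wpM2l ?exprn_ge0 ?invr_ge0 ?ler0n //; apply: IH => //.
    rewrite map_inj_in_uniq ?filter_uniq // => m m' ms ms' e.
    by rewrite -(dK m ms) -(dK m' ms') e.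
  move=> _ /mapP[m ms ->]; have [ms' li] := siP m ms.
  have [m0 mp] := sm m ms'.
  have d0 : (0 < m %/ q ^ i)%N.
    by rewrite divn_gt0 ?expn_gt0 ?prime_gt0 // dvdn_leq // -li pfactor_dvdnn.
  split=> // p pp pd; have := mp p pp; rewrite inE.
  move=> /(_ (dvdn_trans pd _)); rewrite -{2}(dK m ms) dvdn_mulr // => /(_ isT).
  case/orP => // /eqP pe; exfalso.
  move: li; rewrite -{1}(dK m ms) lognM // ?expn_gt0 ?prime_gt0 //.
  rewrite (pfactorK _ pq) => /eqP; rewrite -[X in _ == X]add0n eqn_add2r => /eqP l0.
  have := logn_gt0 q (m %/ q ^ i)%N; rewrite l0.
  by rewrite mem_primes pq d0 -[X in (X %| _)%N]pe pd.
apply: le_trans (ler_sum _ (fun i _ => step i)) _.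
rewrite -mulr_suml ler_wpM2r //; apply: geom_le.
by rewrite invr_ge0 ler0n invf_lt1 //; apply: lt_trans q1.
Qed.

Lemma ln_le_harmonic (R : realType) x :
  ln (x.+1%:R : R) <= \sum_(m <- iota 1 x) m%:R^-1.
Proof.
elim: x => [|x IH]; first by rewrite ln1 big_nil.
rewrite -[X in iota 1 X]addn1 iotaD big_cat /= big_seq1 add1n.
have x0 : 0 < x.+1%:R :> R by rewrite ltr0n.
have -> : x.+2%:R = x.+1%:R * (1 + x.+1%:R^-1) :> R.
  by rewrite mulrDr mulr1 divff ?gt_eqF // natr1.
have i0 : 0 < x.+1%:R^-1 :> R by rewrite invr_gt0.
rewrite lnM ?posrE ?addr_gt0 // lerD //.
by apply: le_ln1Dx; apply: lt_trans i0; rewrite oppr_lt0.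
Qed.

Definition odd_primes (x : nat) : seq nat :=
  [seq p <- index_iota 0 x.+1 | prime p && odd p].

Lemma mem_odd_primes x p :
  (p \in odd_primes x) = [&& prime p, odd p & (p <= x)%N].
Proof. by rewrite mem_filter mem_index_iota ltnS -andbA. Qed.

Lemma odd_primes_ge3 x p : p \in odd_primes x -> (3 <= p)%N.
Proof.
by rewrite mem_odd_primes => /and3P[]; case: p => [|[|[|]]].
Qed.

Lemma odd_primes_prime x : all prime (odd_primes x).
Proof. by apply/allP => p; rewrite mem_odd_primes => /and3P[]. Qed.

Lemma odd_primes_uniq x : uniq (odd_primes x).
Proof. by rewrite filter_uniq // iota_uniq. Qed.

(** The sum telescopes, since 1/(x+1)^2 <= 1/x - 1/(x+1). *)
Lemma sum_inv_sq_le1 (R : realFieldType) x :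
  \sum_(p <- odd_primes x) (p%:R^-1 : R) ^+ 2 <= 1.
Proof.
case: x => [|x]; first by rewrite (_ : odd_primes 0 = [::]) // big_nil ler01.
suff : \sum_(p <- odd_primes x.+1) (p%:R^-1 : R) ^+ 2 <= 1 - x.+1%:R^-1.
  by move=> /le_trans; apply; rewrite gerBl invr_ge0 ler0n.
elim: x => [|x IH].
  by rewrite (_ : odd_primes 1 = [::]) // big_nil invr1 subrr.
rewrite big_filter big_mkcond big_nat_recr //= -big_mkcond -big_filter /=.
apply: le_trans (lerD IH (_ : _ <= x.+1%:R^-1 - x.+2%:R^-1)) _; last first.
  by rewrite addrA subrK.
have x0 : 0 < x.+1%:R :> R by rewrite ltr0n.
have x1 : x.+2%:R = x.+1%:R + 1 :> R by rewrite natr1.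
have y0 : 0 < x.+2%:R :> R by rewrite ltr0n.
apply: (@le_trans _ _ (x.+2%:R^-1 ^+ 2)).
  by case: ifP => // _; rewrite sqr_ge0.
rewrite -subr_ge0.
have -> : x.+1%:R^-1 - x.+2%:R^-1 - x.+2%:R^-1 ^+ 2 =
    x.+1%:R^-1 * x.+2%:R^-1 ^+ 2 :> R.
  rewrite x1 in y0 *; move: (x.+1%:R) x0 y0 => a a0 b0.
  by field; rewrite !gt_eqF.
by rewrite mulr_ge0 ?sqr_ge0 // invr_ge0 ltW.
Qed.

Definition recip_sum (R : realType) (x : nat) : R :=
  \sum_(p <- odd_primes x) p%:R^-1.

Lemma inv_ge3 (R : realFieldType) x p :
  p \in odd_primes x -> 0 <= (p%:R^-1 : R) <= 1 / 3.
Proof.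
move=> /odd_primes_ge3 p3; rewrite invr_ge0 ler0n /= div1r lef_pV2 ?posrE ?ler_nat //.
by rewrite ltr0n (leq_trans _ p3).
Qed.

(** The easy half of Mertens' theorem: by Euler's product the harmonic sum up to x
is at most the product of the 1 / (1 - 1/p) over the primes p up to x.  The
prime 2 contributes the factor 2, and for the others
1 / (1 - t) <= e^(t + 3 t^2 / 2). *)
Lemma ln_le_exp_recip_sum (R : realType) x :
  ln (x.+1%:R : R) <= 2 * expR (3 / 2) * expR (recip_sum R x).
Proof.
apply: le_trans (ln_le_harmonic R x) _.
apply: (@le_trans _ _ (\prod_(p <- 2%N :: odd_primes x) (1 - (p%:R^-1 : R))^-1)).
  apply: sum_inv_smooth; first by rewrite /= odd_primes_prime.
    exact: iota_uniq.
  move=> m; rewrite mem_iota add1n ltnS => /andP[m0 mx]; split=> // p pp pm.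
  rewrite inE mem_odd_primes pp (leq_trans (dvdn_leq m0 pm) mx) andbT /=.
  by case/even_prime: (pp) => ->; rewrite ?orbT.
rewrite big_cons (_ : (1 - 2%:R^-1)^-1 = 2); last by field.
rewrite -mulrA ler_pM2l // -expRD addrC.
apply: (@le_trans _ _ (expR (recip_sum R x +
  3 / 2 * \sum_(p <- odd_primes x) (p%:R^-1 : R) ^+ 2))).
  rewrite mulr_sumr -big_split expR_sum big_seq [leRHS]big_seq.
  apply: ler_prod => p /(inv_ge3 R) /andP[]; move: (_^-1) => t t0 t3.
  rewrite invr_ge0 (_ : 0 <= 1 - t) /=; last by lra.
  apply: le_trans (expR_ge1Dx _).
  by rewrite -[leLHS]mul1r ler_pdivrMr; nra.
by rewrite ler_expR lerD2l -[leRHS]mulr1 ler_wpM2l ?sum_inv_sq_le1.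
Qed.

(** * The sum-free and product-free set *)

Lemma tlognE p K m : prime p -> (0 < m)%N -> tlogn p K m = minn (logn p m) K.
Proof.
by move=> pp m0; rewrite /tlogn logn_gcd // ?pfactorK // expn_gt0 prime_gt0.
Qed.

(** If the total stays below K, then no single valuation has been capped. *)
Lemma tOmegaM (L : seq nat) K u v : all prime L -> (0 < u)%N -> (0 < v)%N ->
  (tOmega L K (u * v) < K)%N ->
  tOmega L K (u * v) = (tOmega L K u + tOmega L K v)%N.
Proof.
move=> /allP Lp u0 v0 lt; rewrite /tOmega -big_split /= big_seq [RHS]big_seq.
apply: eq_bigr => p pL; have pp := Lp p pL.
have : (tlogn p K (u * v) < K)%N.
  by apply: leq_ltn_trans lt; rewrite /tOmega (big_rem p) //= leq_addr.
by rewrite !tlognE ?muln_gt0 ?u0 // lognM //; lia.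
Qed.

(** The odd residues whose number of prime factors in L lies in [k, 2k). *)
Definition odd_band (L : seq nat) (K k n : nat) : {set 'Z_n} :=
  [set a : 'Z_n | odd a & (k <= tOmega L K a < k.*2)%N].

Lemma val_ZpD n (a b : 'Z_n) : (1 < n)%N ->
  (a + b)%R = ((a + b) %% n)%N :> nat.
Proof. by move=> n1; rewrite -[X in (_ %% X)%N](Zp_cast n1). Qed.

Lemma val_ZpM n (a b : 'Z_n) : (1 < n)%N ->
  (a * b)%R = ((a * b) %% n)%N :> nat.
Proof. by move=> n1; rewrite -[X in (_ %% X)%N](Zp_cast n1). Qed.

Lemma odd_band_sum_free L K k n : (1 < n)%N -> ~~ odd n ->
  sum_free (odd_band L K k n).
Proof.
move=> n1 en; apply/eqP/setP => z.
rewrite finset.in_setI finset.in_set0; apply/negbTE/negP.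
case/andP => zA /imset2P[a b aA bA e]; move: zA aA bA.
rewrite e !inE => /andP[zo _] /andP[oa _] /andP[ob _]; move: zo.
by rewrite val_ZpD // odd_mod ?(negbTE en) // oddD oa ob.
Qed.

Lemma odd_band_product_free L K k n : (1 < n)%N -> all prime L ->
  (forall p, p \in L -> p ^ K %| n)%N -> (k.*2 <= K)%N ->
  product_free (odd_band L K k n).
Proof.
move=> n1 Lp Ln kK; apply/eqP/setP => z.
rewrite finset.in_setI finset.in_set0; apply/negbTE/negP.
case/andP => zA /imset2P[a b aA bA e]; move: zA aA bA.
rewrite e !inE => /andP[_ /andP[_ lo]] /andP[oa /andP[ka _]] /andP[ob /andP[kb _]].
move: lo; rewrite val_ZpM // tOmega_modn // => lo.
have lt := leq_trans lo kK; move: lo.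
rewrite tOmegaM ?odd_gt0 // => lo.
by move: lo; rewrite ltnNge -addnn leq_add.
Qed.

(** Half of the residues are odd, and an odd residue outside the band falls in one
of its two tails.  M only has to exceed every value of [tOmega]. *)
Lemma density_odd_band (R : realType) (L : seq nat) K k : uniq L -> all prime L ->
  2%N \notin L ->
  let N := (\prod_(p <- L) p ^ K)%N in
  let c j := (\prod_(p <- L) tlogn_gf (p%:R^-1 : R) K)`_j in
  exists M, 1 / 2 - 1 / 2 * (\sum_(0 <= j < k) c j + \sum_(k.*2 <= j < M) c j) <=
    density R (odd_band L K k (2 * N)).
Proof.
move=> uL Lp L2 N c.
have N0 : (0 < N)%N by apply: prod_exp_gt0.
have N0R : 0 < N%:R :> R by rewrite ltr0n.
pose n := (2 * N)%N.
have n1 : (1 < n)%N by rewrite /n; lia.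
pose Om := tOmega L K.
pose M := (\max_(m < n) Om m).+1.
have OmM (m : 'I_n) : (Om m < M)%N.
  by rewrite ltnS (leq_bigmax (F := fun m : 'I_n => Om m)).
exists M.
have cE j : N%:R * c j = \sum_(m < n) (odd m && (Om m == j))%:R.
  have := @sum_crt {poly R} 2 N (fun m => (odd m)%:R) (fun m => 'X^(Om m)).
  rewrite big_ord_recl big_ord1 /= add0r mul1r sum_tOmega // scaler_prod.
  rewrite -natr_prod => /(_ isT N0) h.
  have {}h : \sum_(m < n) (odd m)%:R * 'X^(Om m) =
      N%:R *: \prod_(p <- L) tlogn_gf (p%:R^-1 : R) K.
    apply: h => [|m|m].
    - rewrite coprime2n /N big_seq; elim/big_ind: _ => [//|a b|p pL].
        by rewrite oddM => -> ->.
      rewrite oddX; have /even_prime[p2|->] := allP Lp p pL; last exact: orbT.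
      by move: L2; rewrite -p2 pL.
    - by rewrite modn2; case: (odd m).
    - by rewrite /Om tOmega_modn // => p; apply: dvdn_prod_exp.
  rewrite /c -coefZ -h coef_sum; apply: eq_bigr => m _.
  by case: (odd m); rewrite ?mul0r ?coef0 // mul1r coefXn eq_sym.
have sumodd : \sum_(m < n) (odd m)%:R = N%:R :> R.
  rewrite /n mulnC (sum_mul _ _ _ (fun m => (odd m)%:R : R)).
  rewrite (eq_bigr (fun=> 1)) ?sumr_const ?card_ord // => a _.
  by rewrite big_ord_recl big_ord1 /= !oddD !oddM andbF add0r.
have cardA : #|odd_band L K k n|%:R =
    \sum_(m < n) (odd m && (k <= Om m < k.*2)%N)%:R :> R.
  rewrite -(big_mkord xpredT (fun m => (odd m && (k <= Om m < k.*2)%N)%:R : R)).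
  rewrite -[X in index_iota 0 X](Zp_cast n1) big_mkord -sum1_card natr_sum big_mkcond /=.
  by apply: eq_bigr => a _; rewrite inE; case: ifP.
rewrite /density -/n ler_pdivlMr ?ltr0n ?(ltnW n1) //.
have -> : n%:R = 2 * N%:R :> R by rewrite /n natrM.
rewrite -[_%:R in leRHS]/(#|odd_band L K k n|%:R).
suff : N%:R <= #|odd_band L K k n|%:R +
    (\sum_(0 <= j < k) N%:R * c j + \sum_(k.*2 <= j < M) N%:R * c j).
  by rewrite -!mulr_sumr; lra.
rewrite cardA -{1}sumodd !(eq_bigr _ (fun j _ => cE j)).
rewrite exchange_big [X in _ + (_ + X)]exchange_big -!big_split /=.
apply: ler_sum => m _; case: (odd m) => /=; last first.
  by rewrite !addr_ge0 // sumr_ge0.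
have pick a b : (a <= Om m < b)%N ->
    1 <= \sum_(a <= j < b) (Om m == j)%:R :> R.
  move=> ab; rewrite (bigD1_seq (Om m)) ?mem_index_iota ?iota_uniq //=.
  by rewrite eqxx lerDl sumr_ge0.
have nn a b : 0 <= \sum_(a <= j < b) (Om m == j)%:R :> R by rewrite sumr_ge0.
have [lk|kl] := ltnP (Om m) k.
  have := pick 0%N k lk; have := nn k.*2 M.
  by rewrite /= add0r; lra.
have [lk|kl'] := ltnP (Om m) k.*2; rewrite ?kl //=.
  by rewrite lerDl addr_ge0.
have := pick k.*2 M; rewrite kl' OmM => /(_ isT); have := nn 0%N k; lra.
Qed.

(** * The two tails *)

Lemma lt2_expR1 (R : realType) : 2 < expR 1 :> R.
Proof. by have := @expR_gt1Dx R 1 (oner_neq0 _). Qed.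

(** From e^(-1/4) >= 3/4 and (3/4)^4 > 1/4. *)
Lemma expR1_lt4 (R : realType) : expR 1 < 4 :> R.
Proof.
have h : 3 / 4 <= expR (- (1 / 4)) :> R.
  by apply: le_trans (expR_ge1Dx _); lra.
have e : expR (- (1 / 4)) ^+ 4 * expR 1 = 1 :> R.
  rewrite -expRM_natl -expRD (_ : _ + _ = 0) ?expR0 //; lra.
have h4 : (3 / 4) ^+ 4 <= expR (- (1 / 4)) ^+ 4 :> R.
  by rewrite lerXn2r ?nnegrE ?expR_ge0 //; lra.
have : (3 / 4) ^+ 4 * expR 1 <= 1 :> R by rewrite -[leRHS]e ler_pM2r ?expR_gt0.
rewrite !exprS expr0; lra.
Qed.

(** The proportion of residues with Omega = j, against the Poisson weight at an
arbitrary J.  The constant e^24 bounds the product of the 1 + 24/p^2. *)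
Lemma coef_prod_tlogn_gf_le (R : realType) (x K J j : nat) :
  (2 <= K)%N -> (0 < J)%N -> 0 < recip_sum R x -> J%:R <= 2 * recip_sum R x ->
  (\prod_(p <- odd_primes x) tlogn_gf (p%:R^-1 : R) K)`_j <=
  expR 24 * expR (- recip_sum R x) * (recip_sum R x ^+ J / J`!%:R) *
    ((recip_sum R x / J%:R) ^+ j / (recip_sum R x / J%:R) ^+ J).
Proof.
set l := recip_sum R x => K2 J0 l0 Jl.
pose s : seq R := [seq p%:R^-1 | p <- odd_primes x].
have s3 t : t \in s -> 0 <= t <= 1 / 3 by move=> /mapP[p pL ->]; apply: inv_ge3 pL.
have lE : \sum_(t <- s) t = l by rewrite /s big_map.
have -> : \prod_(p <- odd_primes x) tlogn_gf (p%:R^-1 : R) K =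
  \prod_(t <- s) tlogn_gf t K by rewrite /s big_map.
have /andP[_ h] := prod_tlogn_gf_le _ j K s j s3 K2 (leqnn _).
apply: le_trans h _; rewrite lE.
set H := \prod_(t <- s) tail_poly j t.
have H0 : H \is a polyOver Num.nneg.
  apply: nneg_poly_prod => t /s3 /andP[t0 _].
  exact: tail_poly_nneg.
have H2 : H.[2] <= expR 24.
  rewrite /H horner_prod.
  apply: (@le_trans _ _ (expR (24 *
    \sum_(p <- odd_primes x) (p%:R^-1 : R) ^+ 2))); last first.
    by rewrite ler_expR -[leRHS]mulr1 ler_pM2l // sum_inv_sq_le1.
  rewrite /s big_map mulr_sumr expR_sum big_seq [leRHS]big_seq.
  apply: ler_prod => p /(inv_ge3 R) p3; have /andP[p0 _] := p3.
  apply/andP; split; last first.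
    by apply: le_trans (tail_poly_horner2 _ _ _ p3) (expR_ge1Dx _).
  rewrite horner_coef sumr_ge0 // => i _; rewrite mulr_ge0 ?exprn_ge0 // -nnegrE.
  by rewrite (polyOverP _) // tail_poly_nneg.
have P1 : \prod_(t <- s) (1 - t) <= expR (- l).
  rewrite -lE -sumrN expR_sum big_seq [leRHS]big_seq.
  apply: ler_prod => t /s3 /andP[t0 t3]; rewrite expR_ge1Dx andbT; lra.
have Jr : 0 < J%:R :> R by rewrite ltr0n.
have r0 : 0 < l / J%:R by rewrite divr_gt0.
have pi0 : 0 <= l ^+ J / J`!%:R by rewrite divr_ge0 ?exprn_ge0 ?ler0n // ltW.
have q0 : 0 <= (l / J%:R) ^+ j / (l / J%:R) ^+ J.
  by rewrite divr_ge0 ?exprn_ge0 // ltW.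
apply: (@le_trans _ _ (expR (- l) * (l ^+ J / J`!%:R / (l / J%:R) ^+ J * H.[2] *
    (l / J%:R) ^+ j))).
  apply: ler_pM => //; last exact: coef_exp_polyM_le.
    by rewrite big_seq prodr_ge0 // => t /s3 /andP[t0 t3]; lra.
  by rewrite -nnegrE (polyOverP _) // nneg_polyM // exp_poly_nneg // ltW.
have -> : expR (- l) * (l ^+ J / J`!%:R / (l / J%:R) ^+ J * H.[2] *
    (l / J%:R) ^+ j) = H.[2] * (expR (- l) * (l ^+ J / J`!%:R) *
    ((l / J%:R) ^+ j / (l / J%:R) ^+ J)) by ring.
have -> : expR 24 * expR (- l) * (l ^+ J / J`!%:R) *
    ((l / J%:R) ^+ j / (l / J%:R) ^+ J) =
  expR 24 * (expR (- l) * (l ^+ J / J`!%:R) *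
    ((l / J%:R) ^+ j / (l / J%:R) ^+ J)) by ring.
apply: ler_wpM2r => //; apply: mulr_ge0 => //.
by apply: mulr_ge0 => //; apply: expR_ge0.
Qed.

Lemma geom_below_le (R : realFieldType) (r c : R) (J : nat) :
  0 < r -> r^-1 <= c -> c < 1 ->
  \sum_(0 <= j < J.+1) r ^+ j / r ^+ J <= (1 - c)^-1.
Proof.
move=> r0 rc c1; rewrite big_nat_rev big_mkord.
have r01 : 0 <= r^-1 < 1 by rewrite invr_ge0 (ltW r0) (le_lt_trans rc).
apply: (@le_trans _ _ (1 - r^-1)^-1).
  rewrite (eq_bigr (fun i : 'I_J.+1 => r^-1 ^+ i)) ?geom_le // => i _.
  have iJ : (i <= J)%N by rewrite -ltnS.
  rewrite add0n subSS -[in X in _ / X](subnK iJ) exprD exprVn invfM mulrA divff ?mul1r //.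
  by rewrite expf_neq0 // gt_eqF.
by rewrite lef_pV2 ?posrE; lra.
Qed.

Lemma geom_above_le (R : realFieldType) (r c : R) (J M : nat) :
  0 < r -> r <= c -> c < 1 ->
  \sum_(J <= j < M) r ^+ j / r ^+ J <= (1 - c)^-1.
Proof.
move=> r0 rc c1; rewrite -{1}(add0n J) big_addn big_mkord.
apply: (@le_trans _ _ (1 - r)^-1).
  rewrite (eq_bigr (fun i : 'I_(M - J) => r ^+ i)) => [|i _].
    by apply: geom_le; rewrite (ltW r0) (le_lt_trans rc).
  by rewrite exprD mulfK // expf_neq0 // gt_eqF.
by rewrite lef_pV2 ?posrE; lra.
Qed.

(** A Poisson weight of mean l near J = a l, compared through (1/a)^J with the
weight of mean a l, for which J is the mode.  The hypothesis says that J lies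
on the side of a l where (1/a)^J <= (1/a)^(a l): below it if a < 1, above it
if a > 1. *)
Lemma poisson_mode_le (R : realType) (a l : R) (J : nat) :
  0 < a -> 0 < l -> (0 < J)%N -> J%:R * - ln a <= a * l * - ln a ->
  l ^+ J / J`!%:R * Num.sqrt J%:R <= expR (a * l * (1 - ln a)).
Proof.
move=> a0 l0 J0 h; have al0 : 0 < a * l by rewrite mulr_gt0.
have := poisson_le R (a * l) J al0 J0.
have ea : a ^+ J = expR (J%:R * ln a) by rewrite expRM_natl lnK.
rewrite exprMn ea => p.
have -> : expR (a * l * (1 - ln a)) = expR (a * l * - ln a) * expR (a * l).
  by rewrite -expRD; congr expR; ring.
apply: (@le_trans _ _ (expR (J%:R * - ln a) * expR (a * l))); last first.
  by rewrite ler_pM2r ?expR_gt0 // ler_expR.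
rewrite mulrN expRN [leRHS]mulrC ler_pdivlMr ?expR_gt0 //.
by apply: le_trans p; rewrite le_eqVlt; apply/orP; left; apply/eqP; ring.
Qed.

Lemma size_odd_primes x : (size (odd_primes x) <= x)%N.
Proof.
rewrite /odd_primes size_filter /index_iota subn0 /= add0n.
by apply: leq_trans (count_size _ _) _; rewrite size_iota.
Qed.

Lemma recip_sum_le (R : realType) x : 3 * recip_sum R x <= x%:R.
Proof.
apply: (@le_trans _ _ (size (odd_primes x))%:R); last by rewrite ler_nat size_odd_primes.
rewrite -sum1_size natr_sum mulr_sumr big_seq [leRHS]big_seq.
by apply: ler_sum => p /(inv_ge3 R) /andP[_ h]; lra.
Qed.

Definition modulus (x : nat) : nat := (2 * \prod_(p <- odd_primes x) p ^ x)%N.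

(** Twice the first inverse comes from the lower tail and the second inverse from
the upper tail: they sum the geometric series of ratios e/4 and 2/e. *)
Definition error_const (R : realType) : R :=
  1 / 2 * expR 24 * (2 / (1 - expR 1 / 4) + (1 - (expR 1 / 2)^-1)^-1).

Lemma Dprime_ge_band (R : realType) x k : (2 <= x)%N -> (k.*2 <= x)%N ->
  let c j := (\prod_(p <- odd_primes x) tlogn_gf (p%:R^-1 : R) x)`_j in
  exists M, 1 / 2 - 1 / 2 * (\sum_(0 <= j < k) c j + \sum_(k.*2 <= j < M) c j)
    <= Dprime R (modulus x).
Proof.
move=> x2 kx c; have Lp := odd_primes_prime x.
have N0 : (0 < \prod_(p <- odd_primes x) p ^ x)%N by apply: prod_exp_gt0.
have n1 : (1 < modulus x)%N by rewrite /modulus; lia.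
have L2 : 2%N \notin odd_primes x by rewrite mem_odd_primes andbF.
have [M hM] := density_odd_band R (odd_primes x) x k (odd_primes_uniq x) Lp L2.
exists M; apply: le_trans hM _; rewrite /Dprime -/(modulus x).
apply: (le_bigmax_cond 0 (fun A => density R A)).
rewrite odd_band_sum_free ?odd_band_product_free // /modulus.
  by move=> p pL; rewrite dvdn_mull // dvdn_prod_exp.
by rewrite oddM.
Qed.

(** The choice c = e/4 balances the tails: up to a factor of order
1 / sqrt l, l^j/j! is about (e/c)^(c l) = 4^(c l) for j close to c l, and about
(e/(2c))^(2 c l) = 2^(2 c l), which is the same, for j close to 2 c l. *)
Lemma Dprime_ge (R : realType) x (l := recip_sum R x) : (2 <= x)%N -> 4 <= l ->
  1 <= (1 - expR 1 / 4) * l ->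
  1 / 2 - error_const R * expR (- (1 - expR 1 / 2 * ln 2) * l) / Num.sqrt l
    <= Dprime R (modulus x).
Proof.
move=> x2 l4 lc; set c : R := expR 1 / 4 in lc *.
have e2 := lt2_expR1 R; have e4 := expR1_lt4 R.
have c1 : c < 1 by rewrite /c; lra.
have c12 : 1 / 2 < c by rewrite /c; lra.
have l0 : 0 < l by lra.
have cl0 : 0 <= c * l by rewrite mulr_ge0; lra.
pose J := Num.truncn (c * l).
have /andP[Jle ltJ] := truncn_itv cl0; rewrite -/J -natr1 in Jle ltJ.
have cl2 : 2 < c * l by nra.
have J0 : (0 < J)%N by rewrite truncn_gt0; lra.
have JR0 : 0 < J%:R :> R by rewrite ltr0n.
pose k := J.+1.
have kR : (k.*2)%:R = 2 * J%:R + 2 :> R.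
  by rewrite -muln2 natrM /k -[J.+1%:R]natr1; ring.
have k2l : (k.*2)%:R <= 2 * l by rewrite kR; move: lc; rewrite mulrBl mul1r; lra.
have kx : (k.*2 <= x)%N.
  by rewrite -(ler_nat R); have := recip_sum_le R x; rewrite -/l; lra.
have [M] := Dprime_ge_band R x k x2 kx.
pose d j : R := (\prod_(p <- odd_primes x) tlogn_gf (p%:R^-1 : R) x)`_j.
pose sl := \sum_(0 <= j < k) d j; pose su := \sum_(k.*2 <= j < M) d j.
move=> h; have {h} hM : 1 / 2 - 1 / 2 * (sl + su) <= Dprime R (modulus x) := h.
have [ln4 ln2c] : ln c = 1 - 2 * ln 2 /\ ln (2 * c) = 1 - ln 2.
  have -> : 2 * c = expR 1 / 2 by rewrite /c; lra.
  rewrite /c !ln_div ?posrE ?expR_gt0 // expRK; split=> //.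
  have -> : 4 = 2 * 2 :> R by lra.
  by rewrite lnM ?posrE //; lra.
have lnc0 : 0 <= - ln c by rewrite oppr_ge0 ln_le0 // ltW.
have ln2c0 : 0 <= ln (2 * c) by rewrite ln_ge0; lra.
pose E := expR (expR 1 / 2 * ln 2 * l).
have sq0 : 0 < Num.sqrt l by rewrite sqrtr_gt0.
have pl : l ^+ J / J`!%:R * Num.sqrt l <= 2 * E.
  have h : l ^+ J / J`!%:R * Num.sqrt J%:R <= E.
    have c0 : 0 < c by lra.
    apply: le_trans (poisson_mode_le R c l J c0 l0 J0 _) _.
      by rewrite ler_wpM2r.
    by rewrite ler_expR ln4 /c le_eqVlt; apply/orP; left; apply/eqP; field.
  apply: (@le_trans _ _ (l ^+ J / J`!%:R * (2 * Num.sqrt J%:R))); last first.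
    by rewrite mulrCA ler_pM2l.
  rewrite ler_wpM2l ?divr_ge0 ?exprn_ge0 ?ler0n //; first exact: ltW.
  rewrite -[leRHS]ger0_norm ?mulr_ge0 ?sqrtr_ge0 // -sqrtr_sqr.
  rewrite ler_sqrt ?exprn_ge0 ?mulr_ge0 ?sqrtr_ge0 //.
  by rewrite exprMn sqr_sqrtr ?ltW // expr2; nra.
have pu : l ^+ k.*2 / (k.*2)`!%:R * Num.sqrt l <= E.
  have c20 : 0 < 2 * c by lra.
  apply: (@le_trans _ _ (l ^+ k.*2 / (k.*2)`!%:R * Num.sqrt (k.*2)%:R)).
    rewrite ler_wpM2l ?divr_ge0 ?exprn_ge0 ?ler0n //; first exact: ltW.
    by rewrite ler_wsqrtr // kR; nra.
  apply: le_trans (poisson_mode_le R (2 * c) l k.*2 c20 l0 _ _) _ => //.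
    by rewrite !mulrN lerN2 ler_wpM2r // kR; lra.
  by rewrite ler_expR ln2c /c le_eqVlt; apply/orP; left; apply/eqP; field.
have kk0 : (0 < k.*2)%N by [].
have JR : J%:R <= 2 * l by nra.
pose D := expR 24 * expR (- l).
have D0 : 0 <= D by rewrite mulr_ge0 ?expR_ge0.
have hsl : sl <= D * (l ^+ J / J`!%:R) * (1 - c)^-1.
  have r0 : 0 < l / J%:R by rewrite divr_gt0.
  have rc : (l / J%:R)^-1 <= c by rewrite invf_div ler_pdivrMr.
  apply: le_trans (ler_wpM2l _ (geom_below_le R _ _ J r0 rc c1)).
    rewrite mulr_sumr; apply: ler_sum => j _.
    by apply: coef_prod_tlogn_gf_le.
  by rewrite mulr_ge0 // divr_ge0 ?exprn_ge0 ?ler0n // ltW.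
have hsu : su <= D * (l ^+ k.*2 / (k.*2)`!%:R) * (1 - (expR 1 / 2)^-1)^-1.
  have r0 : 0 < l / (k.*2)%:R by rewrite divr_gt0 // ltr0n.
  have rc : l / (k.*2)%:R <= (expR 1 / 2)^-1.
    rewrite ler_pdivrMr ?ltr0n // mulrC ler_pdivlMr; last by lra.
    by rewrite kR; move: ltJ; rewrite /c; lra.
  have c2 : (expR 1 / 2)^-1 < 1 :> R by rewrite invf_lt1; lra.
  apply: le_trans (ler_wpM2l _ (geom_above_le R _ _ k.*2 M r0 rc c2)).
    rewrite mulr_sumr; apply: ler_sum => j _.
    by apply: coef_prod_tlogn_gf_le.
  by rewrite mulr_ge0 // divr_ge0 ?exprn_ge0 ?ler0n // ltW.
apply: le_trans hM; rewrite lerD2l lerN2 ler_pdivlMr //.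
have -> : expR (- (1 - expR 1 / 2 * ln 2) * l) = expR (- l) * E.
  by rewrite /E -expRD; congr expR; ring.
set a := (1 - c)^-1 in hsl *; pose b : R := (1 - (expR 1 / 2)^-1)^-1.
rewrite -/b in hsu.
have a0 : 0 <= a by rewrite invr_ge0; lra.
have b0 : 0 <= b by rewrite invr_ge0 subr_ge0 invf_le1; lra.
have q1 : sl * Num.sqrt l <= D * a * (2 * E).
  apply: (@le_trans _ _ (D * a * (l ^+ J / J`!%:R * Num.sqrt l))).
    by rewrite mulrA ler_pM2r // mulrAC.
  by rewrite ler_wpM2l // mulr_ge0.
have q2 : su * Num.sqrt l <= D * b * E.
  apply: (@le_trans _ _ (D * b * (l ^+ k.*2 / (k.*2)`!%:R * Num.sqrt l))).
    by rewrite mulrA ler_pM2r // mulrAC.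
  by rewrite ler_wpM2l // mulr_ge0.
have -> : error_const R * (expR (- l) * E) = 1 / 2 * (D * a * (2 * E) + D * b * E).
  by rewrite /error_const -/c -/a -/b /D; ring.
by lra.
Qed.

(** * The size of the modulus and the conclusion *)

Lemma modulus_gt x : (3 <= x)%N -> (x < modulus x)%N.
Proof.
move=> x3; have Lp := odd_primes_prime x.
have N0 : (0 < \prod_(p <- odd_primes x) p ^ x)%N by apply: prod_exp_gt0.
have : (3 ^ x %| \prod_(p <- odd_primes x) p ^ x)%N.
  by apply: dvdn_prod_exp; rewrite mem_odd_primes x3.
move=> /(dvdn_leq N0) h; apply: leq_trans (leq_trans (ltn_expl x (isT : 1 < 3)%N) h) _.
by rewrite /modulus leq_pmull.
Qed.

Lemma modulus_le x : (2 <= x)%N -> (modulus x <= x ^ (x * x).+1)%N.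
Proof.
move=> x2; rewrite /modulus expnS leq_mul //.
apply: (@leq_trans ((x ^ x) ^ size (odd_primes x))); last first.
  by rewrite -expnM leq_exp2l // leq_mul2l size_odd_primes orbT.
have : {in odd_primes x, forall p, p <= x}%N.
  by move=> p; rewrite mem_odd_primes => /and3P[].
elim: (odd_primes x) => [|p s IH] sx; first by rewrite big_nil.
rewrite big_cons /= expnS leq_mul //.
  by rewrite leq_exp2r ?(ltnW x2) // sx ?mem_head.
by apply: IH => q qs; apply: sx; rewrite inE qs orbT.
Qed.

Lemma ln_modulus_le (R : realType) x : (2 <= x)%N ->
  ln ((modulus x)%:R : R) <= x%:R ^+ 3.
Proof.
move=> x2; have x0 : 0 < x%:R :> R by rewrite ltr0n (leq_trans _ x2).
have x2R : 2 <= x%:R :> R by rewrite (ler_nat R 2).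
have m0 : (0 < modulus x)%N.
  by rewrite /modulus muln_gt0 /= prod_exp_gt0 // odd_primes_prime.
apply: (@le_trans _ _ (ln (x%:R ^+ (x * x).+1))).
  by rewrite ler_ln ?posrE ?ltr0n ?exprn_gt0 // -natrX ler_nat modulus_le.
have lx : ln (x%:R : R) <= x%:R - 1.
  by have := @le_ln1Dx R (x%:R - 1); rewrite (addrC 1) subrK; apply; lra.
rewrite lnXn // -[_ *+ _]mulr_natl -natr1 natrM.
apply: (@le_trans _ _ ((x%:R * x%:R + 1) * (x%:R - 1))).
  by rewrite ler_pM2l //; nra.
rewrite !exprS expr0; nra.
Qed.

(** With c = e/4 this is the inequality c ln c >= c - 1 in disguise, since
ln c = 1 - 2 ln 2.  It makes y `^ (1 - (e/2) ln 2) nondecreasing in y. *)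
Lemma exponent_ge0 (R : realType) : 0 <= 1 - expR 1 / 2 * ln 2 :> R.
Proof.
have e0 : 0 < expR 1 :> R := expR_gt0 _.
have h : ln (4 / expR 1 : R) <= 4 / expR 1 - 1.
  have := @le_ln1Dx R (4 / expR 1 - 1); rewrite (addrC 1) subrK; apply.
  by rewrite ltrBDl addrN divr_gt0.
move: h; rewrite ln_div ?posrE // expRK (_ : 4 = 2 * 2 :> R); last lra.
rewrite lnM ?posrE // => h.
have : expR 1 * (ln 2 + ln 2 - 1) <= expR 1 * (2 * 2 / expR 1 - 1) :> R.
  by rewrite ler_pM2l.
rewrite [leRHS]mulrBr mulrCA divff ?gt_eqF //; lra.
Qed.

Definition mertens_const (R : realType) : R := 2 * expR (3 / 2).

Lemma recip_sum_ge (R : realType) (t : R) x :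
  expR (mertens_const R * expR t) <= x.+1%:R -> t <= recip_sum R x.
Proof.
move=> h; have := ln_le_exp_recip_sum R x; rewrite -/(mertens_const R) => h2.
have B0 : 0 < mertens_const R by rewrite mulr_gt0 ?expR_gt0.
rewrite -ler_expR -(ler_pM2l B0); apply: le_trans h2.
by rewrite -[leLHS]expRK ler_ln ?posrE ?expR_gt0 ?ltr0n.
Qed.

Local Open Scope classical_set_scope.
Local Open Scope ring_scope.

Theorem theorem1p3 (R : realType) :
  exists2 kappa : R, 0 < kappa &
    infinite_set [set n : nat |
      [/\ (0 < n)%N, 0 < ln (ln (ln (n%:R : R))) &
        Dprime R n >=
          1 / 2 - kappa / (ln (ln n%:R) `^ (1 - expR 1 / 2 * ln 2) *
                           ln (ln (ln n%:R)) `^ (1 / 2))]].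
Proof.
have e2 := lt2_expR1 R; have e4 := expR1_lt4 R.
set delta : R := 1 - expR 1 / 2 * ln 2.
have d0 : 0 <= delta := exponent_ge0 R.
set B := mertens_const R.
have B0 : 0 < B by rewrite /B /mertens_const mulr_gt0 ?expR_gt0.
have B3 : 0 < 3 * B by lra.
have C0 : 0 < error_const R.
  have a1 : 0 < 1 - expR 1 / 4 :> R by lra.
  have a2 : 0 < 1 - (expR 1 / 2)^-1 :> R by rewrite subr_gt0 invf_lt1; lra.
  apply: mulr_gt0; first by rewrite mulr_gt0 ?expR_gt0.
  by rewrite addr_gt0 ?invr_gt0 // divr_gt0.
exists (error_const R * ((3 * B) `^ delta * Num.sqrt 2)).
  apply: mulr_gt0 => //; apply: mulr_gt0; first exact: powR_gt0.
  by rewrite sqrtr_gt0.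
(* l0 is the mean required by [Dprime_ge] and by ln (3 * B) <= l; the second
   term of T makes the triple logarithm of the modulus larger than 1. *)
pose l0 : R := 4 + (1 - expR 1 / 4)^-1 + `|ln (3 * B)|.
pose T : R := expR (B * expR l0) + expR (expR (expR 1)).
have key x : (3 <= x)%N -> T <= x%:R ->
    [/\ (0 < modulus x)%N, 0 < ln (ln (ln ((modulus x)%:R : R))) &
        Dprime R (modulus x) >= 1 / 2 -
          error_const R * ((3 * B) `^ delta * Num.sqrt 2) /
          (ln (ln (modulus x)%:R) `^ delta *
           ln (ln (ln (modulus x)%:R)) `^ (1 / 2))].
  move=> x3 Tx; have x2 : (2 <= x)%N by apply: ltnW.
  have mx := modulus_gt x x3.
  have x0 : 0 < x%:R :> R by rewrite ltr0n (leq_trans _ x3).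
  have mxR : x%:R < (modulus x)%:R :> R by rewrite ltr_nat.
  have eT : expR (expR (expR 1)) < (modulus x)%:R :> R.
    by apply: lt_trans mxR; apply: lt_le_trans Tx; rewrite ltrDr expR_gt0.
  set n : R := (modulus x)%:R in mxR eT *.
  have n0 : 0 < n by apply: lt_trans mxR.
  have L1 : expR (expR 1) < ln n.
    by rewrite -ltr_expR lnK.
  have L10 : 0 < ln n by apply: lt_trans L1; apply: expR_gt0.
  have L2 : expR 1 < ln (ln n) by rewrite -ltr_expR lnK.
  have L20 : 0 < ln (ln n) by apply: lt_trans L2; apply: expR_gt0.
  have L3 : 1 < ln (ln (ln n)) by rewrite -ltr_expR lnK.
  have L30 : 0 < ln (ln (ln n)) by lra.
  split => //; first exact: leq_ltn_trans mx.
  have ll : l0 <= recip_sum R x.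
    apply: recip_sum_ge; apply: (@le_trans _ _ T); first by rewrite lerDl expR_ge0.
    by apply: le_trans Tx _; rewrite ler_nat.
  have cinv : 0 < (1 - expR 1 / 4)^-1 :> R by rewrite invr_gt0; lra.
  set l := recip_sum R x in ll *.
  have l4 : 4 <= l.
    by apply: le_trans ll; have := normr_ge0 (ln (3 * B)); rewrite /l0; lra.
  have lc : 1 <= (1 - expR 1 / 4) * l.
    rewrite mulrC -ler_pdivrMr ?div1r; last by lra.
    by apply: le_trans ll; have := normr_ge0 (ln (3 * B)); rewrite /l0; lra.
  have lB : ln (3 * B) <= l.
    by apply: le_trans ll; have := ler_norm (ln (3 * B)); rewrite /l0; lra.
  have lp : 0 < l by lra.
  have u2 : ln (ln n) <= 3 * B * expR l.
    apply: (@le_trans _ _ (ln (x%:R ^+ 3))).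
      by rewrite ler_ln ?posrE ?exprn_gt0 // ln_modulus_le.
    rewrite lnXn // -[_ *+ _]mulr_natl -mulrA ler_pM2l //.
    apply: le_trans (ln_le_exp_recip_sum R x).
    by rewrite ler_ln ?posrE ?ltr0Sn // ler_nat.
  have u3 : ln (ln (ln n)) <= 2 * l.
    apply: (@le_trans _ _ (ln (3 * B * expR l))).
      by rewrite ler_ln ?posrE // mulr_gt0 ?expR_gt0.
    by rewrite lnM ?posrE ?expR_gt0 // expRK; lra.
  have sq : 0 < Num.sqrt l by rewrite sqrtr_gt0.
  have f0 : 0 < ln (ln n) `^ delta * ln (ln (ln n)) `^ (1 / 2).
    by rewrite mulr_gt0 ?powR_gt0.
  have f1 : ln (ln n) `^ delta * ln (ln (ln n)) `^ (1 / 2) <=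
      ((3 * B) `^ delta * expR (delta * l)) * (Num.sqrt 2 * Num.sqrt l).
    apply: ler_pM; rewrite ?powR_ge0 //.
      rewrite [delta * l]mulrC expRM -powRM ?expR_ge0 ?(ltW B3) //.
      by rewrite ge0_ler_powR ?nnegrE ?(ltW L20) // mulr_ge0 ?expR_ge0 // ltW.
    rewrite -sqrtrM // -powR12_sqrt; last by lra.
    by rewrite div1r ge0_ler_powR ?nnegrE //; lra.
  apply: le_trans (Dprime_ge R x x2 l4 lc).
  rewrite lerD2l lerN2 ler_pdivlMr //.
  apply: (@le_trans _ _ (error_const R * expR (- delta * l) / Num.sqrt l *
    (((3 * B) `^ delta * expR (delta * l)) * (Num.sqrt 2 * Num.sqrt l)))).
    rewrite ler_wpM2l // divr_ge0 ?sqrtr_ge0 // mulr_ge0 ?expR_ge0 //.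
    exact: ltW.
  rewrite mulNr expRN le_eqVlt; apply/orP; left; apply/eqP.
  by field; rewrite !gt_eqF ?expR_gt0.
move=> /finite_seqP[s sE].
pose x := maxn (maxn 3 (Num.truncn T).+1) (\max_(i <- s) i)%N.
have x3 : (3 <= x)%N by rewrite /x !leq_max.
have T0 : 0 <= T by rewrite addr_ge0 ?expR_ge0.
have Tx : T <= x%:R.
  apply: (@le_trans _ _ (Num.truncn T).+1%:R).
    by apply: ltW; case/andP: (truncn_itv T0).
  by rewrite ler_nat /x !leq_max leqnn orbT.
have : [set` s] (modulus x) by rewrite -sE; apply: key.
rewrite /= => ms; have := modulus_gt x x3; rewrite ltnNge => /negP; apply.
rewrite {2}/x leq_max; apply/orP; right.
exact: (leq_bigmax_seq (F := fun i => i)).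
Qed.
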